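(* Let $K$ be a field, $S=K[x_1,\ldots,x_n]$, and let $J\subsetneq I\subset S$ be monomial ideals. Let $\overline{I/J}$ be the canonical form of $I/J$. Then $$\operatorname{depth}_S (I/J)=\operatorname{depth}_S\big(\overline{I/J}\big).$$
   Context: Depth is taken with respect to the graded maximal ideal $(x_1,\ldots,x_n)$ of $S$. Canonical form. For a monomial ideal $L\subset S$, $G(L)$ denotes its minimal system of monomial generators. The power $x_j^r$ enters in a monomial $u$ if $x_j^r\mid u$ but $x_j^{r+1}\nmid u$. Let $J\subsetneq I\subset S$ be monomial ideals. The factor $I/J$ is of type $(k_1,\ldots,k_s)$ with respect to $x_j$ if $1\le k_1<\cdots<k_s$ and $x_j^{k_1},\ldots,x_j^{k_s}$ are exactly the powers of $x_j$ with positive exponent which enter in some monomial of $G(I)\cup G(J)$. The canonical form of $I/J$ with respect to $x_j$ is the factor $I'/J'$, where $I'$ (resp. $J'$) is the ideal generated by the monomials obtained from those of $G(I)$ (resp. $G(J)$) by replacing $x_j^{k_i}$ by $x_j^{i}$ whenever $x_j^{k_i}$ enters in the generator; generators not divisible by $x_j$ are left unchanged. The canonical form $\overline{I/J}$ of $I/J$ is obtained by applying this procedure successively with respect to all variables $x_1,\ldots,x_n$. *)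

(* Defs.v *)
From Stdlib Require List.
From HB Require Import structures.
From mathcomp Require Import all_boot all_order all_algebra.
From mathcomp Require Import boolp classical_sets.
From mathcomp Require Import mpoly.

Set Implicit Arguments.
Unset Strict Implicit.
Unset Printing Implicit Defensive.

Import GRing.Theory.
Local Open Scope classical_set_scope.
Local Open Scope ring_scope.

(* Ideals are sets, not [idealr] predicates: the unit ideal must be allowed. *)
Definition is_ideal (R : comNzRingType) (I : set R) : Prop :=
  [/\ I 0, (forall f g, I f -> I g -> I (f + g)) & (forall a f, I f -> I (a * f))].

Definition ideal_gen (R : comNzRingType) (A : set R) : set R :=
  smallest (@is_ideal R) A.

(* The ideal J + (fs) I.  For M = I/J, the quotient M/(fs)M is I/(J + (fs) I). *)
Definition ideal_step (R : comNzRingType) (I J : set R) (fs : seq R) : set R :=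
  ideal_gen (J `|` [set h | exists f g, [/\ f \in fs, I g & h = f * g]]).

(* fs is an M-regular sequence in m, for the module M = I/J: every fs`_i is a
   nonzerodivisor on M/(fs_0, .., fs_(i-1))M, and M/(fs)M is nonzero. *)
Definition regular_seq (R : comNzRingType) (m I J : set R) (fs : seq R) : Prop :=
  [/\ (forall f, f \in fs -> m f),
      (forall i, (i < size fs)%N -> forall g, I g ->
         ideal_step I J (take i fs) (fs`_i * g) -> ideal_step I J (take i fs) g)
    & ideal_step I J fs <> I].

(* Depth of I/J with respect to m: the supremum of the lengths of the
   I/J-regular sequences in m.  [supremum 0] is 0 on an unbounded set; this
   does not occur over K[x_1, .., x_n], where the lengths are at most n. *)
Definition depth (R : comNzRingType) (m I J : set R) : nat :=
  supremum 0%N [set size fs | fs in regular_seq m I J].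

Definition graded_max (n : nat) (K : fieldType) : set {mpoly K[n]} :=
  ideal_gen [set 'X_i | i in [set: 'I_n]].
Arguments graded_max : clear implicits.

Section MonomialIdeals.
Variables (n : nat) (K : fieldType).
Implicit Types (L I J : set {mpoly K[n]}) (A G : set 'X_{1..n}) (j : 'I_n).

Definition mon_ideal A : set {mpoly K[n]} :=
  ideal_gen [set 'X_[m] | m in A].

Definition is_mon_ideal L : Prop := exists A, L = mon_ideal A.

(* G(L), as the monomials of L that are minimal for divisibility; see
   [mingensP] below. *)
Definition mingens L : set 'X_{1..n} :=
  [set m | L 'X_[m] /\ forall m', L 'X_[m'] -> (m' <= m)%MM -> m' = m].

(* ks is the type (k_1 < .. < k_s) of I/J with respect to x_j. *)
Definition is_type j I J (ks : seq nat) : Prop :=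
  sorted ltn ks /\
  forall k, k \in ks <-> (0 < k)%N /\ exists2 m, (mingens I `|` mingens J) m & m j = k.

(* The type exists and is unique, by [type_ofP] and [is_type_uniq] below. *)
Definition type_of j I J : seq nat := xget [::] (is_type j I J).

(* [index] counts from 0, hence the successor. *)
Definition relabel j (ks : seq nat) (m : 'X_{1..n}) : 'X_{1..n} :=
  [multinom if i == j then (if m j == 0%N then 0%N else (index (m j) ks).+1)
            else m i | i < n].

Definition canonical_wrt (P : set {mpoly K[n]} * set {mpoly K[n]}) j :
    set {mpoly K[n]} * set {mpoly K[n]} :=
  let ks := type_of j P.1 P.2 in
  (mon_ideal (relabel j ks @` mingens P.1),
   mon_ideal (relabel j ks @` mingens P.2)).

(* [enum 'I_n] lists the variables in increasing order. *)
Definition canonical_form I J : set {mpoly K[n]} * set {mpoly K[n]} :=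
  foldl canonical_wrt (I, J) (enum 'I_n).

Lemma is_ideal_gen (R : comNzRingType) (B : set R) : is_ideal (ideal_gen B).
Proof.
split=> [C [[]] //|f g If Ig C CB|a f If C CB].
  by have [[_ CD _] _] := CB; apply: CD; [apply: If|apply: Ig].
by have [[_ _ CM] _] := CB; apply: CM; apply: If.
Qed.

Lemma sub_ideal_gen (R : comNzRingType) (B : set R) : B `<=` ideal_gen B.
Proof. by move=> f Bf C [_]; apply. Qed.

Lemma ideal_gen_sub (R : comNzRingType) (B I : set R) :
  is_ideal I -> B `<=` I -> ideal_gen B `<=` I.
Proof. by move=> iI BI f; apply. Qed.

Lemma mon_idealP A f :
  mon_ideal A f <->
  forall m, m \in msupp f -> exists2 a, A a & (a <= m)%MM.
Proof.
split.
  move: f; apply: (@ideal_gen_sub _ _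
    [set f | forall m, m \in msupp f -> exists2 a, A a & (a <= m)%MM]).
    split=> [m|g h Ig Ih m|a g Ig m] /=; first by rewrite msupp0.
      by move/msuppD_le; rewrite mem_cat => /orP[/Ig|/Ih].
    move/msuppM_le/allpairsP => [[u v] /= [_ /Ig[b Ab bv] ->]].
    by exists b => //; apply: (lepm_trans bv); rewrite lem_addl.
  by move=> _ [a Aa <-] m; rewrite msuppX inE => /eqP->; exists a; rewrite ?lepm_refl.
move=> fA; rewrite (mpolyE f).
have [i0 iD iM] := is_ideal_gen [set ('X_[m] : {mpoly K[n]}) | m in A].
rewrite big_seq; elim/big_ind: _ => // m /fA[a Aa am].
rewrite -(submK am) mpolyXD scalerAl; apply: iM.
by apply: sub_ideal_gen; exists a.
Qed.

Lemma mon_idealX A m :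
  mon_ideal A 'X_[m] <-> exists2 a, A a & (a <= m)%MM.
Proof.
split=> [/mon_idealP|[a Aa am]]; first by apply; rewrite msuppX inE.
by apply/mon_idealP => m'; rewrite msuppX inE => /eqP->; exists a.
Qed.

Lemma mingens_below L m :
  L 'X_[m] -> exists2 a, mingens L a & (a <= m)%MM.
Proof.
have [k] := ubnP (mdeg m); elim: k m => // k IH m mk Lm.
have [mL|] := pselect (mingens L m); first by exists m; rewrite ?lepm_refl.
move/not_andP => [//|/existsNP[m' /not_implyP[Lm' /not_implyP[m'm nm]]]].
have [|a Ga am'] := IH m' _ Lm'; last by exists a => //; apply: lepm_trans m'm.
rewrite ltnS in mk; apply: leq_trans mk.
rewrite -(submK m'm) mdegD -[X in (X < _)%N]add0n ltn_add2r lt0n.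
apply/eqP => /eqP; rewrite mdeg_eq0 => /eqP e; apply: nm.
by rewrite -(submK m'm) e add0m.
Qed.

(* G(L) is the unique minimal monomial generating set of L. *)
Lemma mingensP L : is_mon_ideal L -> forall A,
  A = mingens L <->
  L = mon_ideal A /\ forall B, B `<=` A -> L = mon_ideal B -> B = A.
Proof.
move=> [A0 LA0].
have gen : L = mon_ideal (mingens L).
  apply/seteqP; split=> f.
    rewrite {1}LA0 => /mon_idealP fL; apply/mon_idealP => m /fL[a Aa am].
    have [|b Gb ba] := @mingens_below L a; last by exists b => //; apply: lepm_trans am.
    by rewrite LA0; apply/mon_idealX; exists a; rewrite ?lepm_refl.
  apply: ideal_gen_sub => [|_ [m [Lm _] <-]//].
  by rewrite LA0; exact: is_ideal_gen.
have least B : L = mon_ideal B -> mingens L `<=` B.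
  move=> LB m [Lm min_m]; move: Lm; rewrite {1}LB => /mon_idealX[b Bb bm].
  by rewrite -(min_m b)// LB; apply/mon_idealX; exists b; rewrite ?lepm_refl.
move=> A; split=> [->|[LA minA]].
  by split=> // B BG LB; apply/seteqP; split=> //; exact: least.
by apply/esym/minA => //; exact: least.
Qed.

Lemma is_type_uniq j I J ks ks' :
  is_type j I J ks -> is_type j I J ks' -> ks = ks'.
Proof.
move=> [s1 m1] [s2 m2].
apply: (irr_sorted_eq ltn_trans ltnn) => // k.
by apply/idP/idP => [/m1/m2|/m2/m1].
Qed.

Lemma dickson (k : nat) (B : set (nat -> nat)) :
  exists2 s : seq (nat -> nat), (forall a, List.In a s -> B a) &
    forall b, B b -> exists2 a, List.In a s & forall i, (i < k)%N -> (a i <= b i)%N.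
Proof.
elim: k B => [|k IH] B.
  have [[b Bb]|nB] := pselect (exists b, B b).
    by exists [:: b] => [a [<-|]//|c _]; exists b => //; left.
  by exists [::] => // b Bb; case: nB; exists b.
have [s sB sP] := IH B.
have [N NP] : exists N, forall a, List.In a s -> (a k <= N)%N.
  elim: {sB sP} s => [|x s [N NP]]; first by exists 0%N.
  exists (maxn (x k) N) => a [<-|/NP aN]; first exact: leq_maxl.
  by rewrite leq_max aN orbT.
have [t tB tP] : exists2 t : seq (nat -> nat), (forall a, List.In a t -> B a) &
    forall b, B b -> (b k < N)%N ->
      exists2 a, List.In a t & forall i, (i < k.+1)%N -> (a i <= b i)%N.
  elim: N {NP} => [|N [t tB tP]]; first by exists [::].
  have [u uB uP] := IH [set b | B b /\ b k = N].
  exists (u ++ t) => [a /List.in_app_iff[/uB[]//|/tB//]|b Bb].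
  rewrite ltnS leq_eqVlt => /orP[/eqP bN|/(tP _ Bb)[a ta ab]]; last first.
    by exists a => //; apply/List.in_app_iff; right.
  have [a ua ab] := uP b (conj Bb bN); exists a.
    by apply/List.in_app_iff; left.
  move=> i; rewrite ltnS leq_eqVlt => /orP[/eqP->|/ab//].
  by have [_ ->] := uB _ ua; rewrite bN.
exists (s ++ t) => [a /List.in_app_iff[/sB|/tB]//|b Bb].
have [bN|Nb] := ltnP (b k) N.
  have [a ta ab] := tP _ Bb bN; exists a => //.
  by apply/List.in_app_iff; right.
have [a sa ab] := sP _ Bb; exists a; first by apply/List.in_app_iff; left.
move=> i; rewrite ltnS leq_eqVlt => /orP[/eqP->|/ab//].
exact: leq_trans (NP _ sa) Nb.
Qed.

Lemma mingens_exp_bounded L j :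
  exists N, forall m, mingens L m -> (m j <= N)%N.
Proof.
pose ev (m : 'X_{1..n}) (i : nat) := if insub i is Some i' then m i' else 0%N.
have evE m (i : 'I_n) : ev m i = m i by rewrite /ev valK.
have [s sL sP] := dickson n (ev @` [set m | L 'X_[m]]).
have [N NP] : exists N, forall a, List.In a s -> (a j <= N)%N.
  elim: {sL sP} s => [|x s [N NP]]; first by exists 0%N.
  exists (maxn (x j) N) => a [<-|/NP aN]; first exact: leq_maxl.
  by rewrite leq_max aN orbT.
exists N => m [Lm min_m].
have [|a sa am] := sP (ev m); first by exists m.
have [m' Lm' e] := sL _ sa.
rewrite -(min_m m' Lm'); first by rewrite -evE e; exact: NP.
by apply/mnm_lepP => i; rewrite -!evE e; exact: am.
Qed.

Lemma type_ofP j I J : is_type j I J (type_of j I J).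
Proof.
rewrite /type_of; case: xgetP => [ks _ //|noks].
have [NI NIP] := mingens_exp_bounded I j.
have [NJ NJP] := mingens_exp_bounded J j.
pose P k := `[< exists2 m, (mingens I `|` mingens J) m & m j = k >].
case: (noks [seq k <- iota 1 (maxn NI NJ) | P k]); split.
  exact/(sorted_filter ltn_trans)/iota_ltn_sorted.
move=> k; rewrite mem_filter mem_iota add1n ltnS; split.
  by move=> /andP[/asboolP Pk /andP[]].
move=> [k0 [m Gm mk]]; apply/andP; split; first by apply/asboolP; exists m.
by rewrite k0 leq_max -mk; case: Gm => [/NIP->|/NJP->]; rewrite ?orbT.
Qed.

End MonomialIdeals.

(* Main.v *)
Require Import Defs.
From mathcomp Require Import all_boot all_order all_algebra.
From mathcomp Require Import boolp classical_sets.
From mathcomp Require Import mpoly ring.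

(* Write x = x_j and M = I/J = \bigoplus_a M_a x^a for the x-grading, each M_a
   being a module over the polynomials without x.  Passing to the canonical form
   with respect to x only deletes or adds degrees a from which the multiplication
   M_a -> M_(a+1) is an isomorphism, and this persists modulo a polynomial without
   x.  Take a regular sequence zs, maximal among those made of elements of
   m = (x_1, .., x_n) that do not involve x.  It is then maximal for the canonical
   form M' too, and M/(zs)M has a nonzero element killed by m if and only if
   M'/(zs)M' has one.  If so, zs is maximal in m and the depth of both modules is
   the length of zs.  Otherwise every y in m that is regular on M/(zs)M completes
   zs to a maximal regular sequence: with U the set of elements of M/(zs)M that are
   killed by the elements of m without x, y acts on U as x p for some p, and p u is
   killed by m modulo y for u in U of least x-degree.  That the length of any one
   maximal regular sequence is the depth is Rees' theorem, obtained by exchanging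
   elements of two sequences against an element regular on all the intermediate
   quotients; the latter comes from prime avoidance. *)

Set Implicit Arguments.
Unset Strict Implicit.
Unset Printing Implicit Defensive.

Import Order.TTheory GRing.Theory.
Local Open Scope classical_set_scope.
Local Open Scope ring_scope.

(** * Regular sequences and socles over a noetherian ring *)

Section Ideals.
Variable R : comNzRingType.
Implicit Types (I L E : set R) (f g h u z : R) (fs gs : seq R).

Lemma ideal0 L : is_ideal L -> L 0.
Proof. by case. Qed.

Lemma idealD L f g : is_ideal L -> L f -> L g -> L (f + g).
Proof. by case=> _ LD _; apply: LD. Qed.

Lemma idealM L f g : is_ideal L -> L g -> L (f * g).
Proof. by case=> _ _; apply. Qed.

Lemma idealB L f g : is_ideal L -> L f -> L g -> L (f - g).
Proof. by move=> iL Lf Lg; rewrite -mulN1r; apply: idealD => //; exact: idealM. Qed.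

Lemma ideal_sum L (T : Type) (r : seq T) (P : pred T) (F : T -> R) :
  is_ideal L -> (forall i, P i -> L (F i)) -> L (\sum_(i <- r | P i) F i).
Proof.
move=> iL LF; elim/big_rec: _ => [|i x Pi Lx]; first exact: ideal0.
by apply: idealD => //; exact: LF.
Qed.

(* For M = I/L, the quotient M/fM is I/(step I L f). *)
Definition step I L f : set R :=
  [set h | exists l g, [/\ L l, I g & h = l + f * g]].

Definition nzd I L f : Prop := forall g, I g -> L (f * g) -> L g.

(** [E] is an arbitrary set because it stands both for the ideal m and for [x_free_max], which in
    general is not an ideal of S. *)
Definition has_socle E I L : Prop :=
  exists2 u, I u /\ ~ L u & forall e, E e -> L (e * u).

(** Regularity without the condition that the last quotient be nonzero. Since [L] varies in the
    recursion, inductions on [fs] pass from M to M/fM. *)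
Fixpoint weak_reg E I L fs : Prop :=
  if fs is f :: fs' then [/\ E f, nzd I L f & weak_reg E I (step I L f) fs']
  else True.

Lemma is_ideal_step I L f : is_ideal I -> is_ideal L -> is_ideal (step I L f).
Proof.
move=> iI iL; split.
- by exists 0, 0; split; rewrite ?mulr0 ?addr0//; exact: ideal0.
- move=> _ _ [l [g [Ll Ig ->]]] [l' [g' [Ll' Ig' ->]]].
  exists (l + l'), (g + g'); split; [exact: idealD|exact: idealD|ring].
- move=> a _ [l [g [Ll Ig ->]]].
  exists (a * l), (a * g); split; [exact: idealM|exact: idealM|ring].
Qed.

Lemma is_ideal_steps I L fs :
  is_ideal I -> is_ideal L -> is_ideal (foldl (step I) L fs).
Proof. by move=> iI; elim: fs L => //= f fs IH L iL; exact/IH/is_ideal_step. Qed.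

Lemma sub_step I L f : is_ideal I -> L `<=` step I L f.
Proof.
by move=> iI l Ll; exists l, 0; split; rewrite ?mulr0 ?addr0//; exact: ideal0.
Qed.

Lemma mul_step I L f g : is_ideal L -> I g -> step I L f (f * g).
Proof. by move=> iL Ig; exists 0, g; split; rewrite ?add0r//; exact: ideal0. Qed.

Lemma stepC I L f g : step I (step I L f) g = step I (step I L g) f.
Proof.
apply/seteqP; split=> _ [_ [v [[l [u [Ll Iu ->]]] Iv ->]]].
  by exists (l + g * v), u; split=> //; [exists l, v|ring].
by exists (l + f * v), u; split=> //; [exists l, v|ring].
Qed.

Lemma steps_step I L fs z :
  foldl (step I) (step I L z) fs = step I (foldl (step I) L fs) z.
Proof. by elim: fs L => //= f fs IH L; rewrite -IH stepC. Qed.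

(** Links the definition of depth to iterated steps. The order of the steps is irrelevant by
    [stepC], so any member of [fs] can be treated as the last one. *)
Lemma ideal_stepE I L fs : is_ideal I -> is_ideal L ->
  ideal_step I L fs = foldl (step I) L fs.
Proof.
move=> iI iL; apply/seteqP; split.
  apply: ideal_gen_sub; first exact: is_ideal_steps.
  move=> h [Lh|[f [g [ffs Ig ->]]]].
    elim: fs L {iL} Lh => //= f fs IH L Lh; exact/IH/sub_step.
  elim: fs L iL ffs => //= k fs IH L iL; rewrite inE => /orP[/eqP->|ffs]; last first.
    by apply: IH => //; exact: is_ideal_step.
  by rewrite steps_step; apply: mul_step => //; exact: is_ideal_steps.
elim/last_ind: fs => [|fs f IH] h; first by move=> Lh; apply: sub_ideal_gen; left.
rewrite foldl_rcons => -[l [g [/IH Ll Ig ->]]].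
apply: (@idealD (ideal_step I L (rcons fs f))); first exact: is_ideal_gen.
  move: l Ll; apply: ideal_gen_sub; first exact: is_ideal_gen.
  move=> k [Lk|[f' [g' [f'fs Ig' ->]]]]; apply: sub_ideal_gen; first by left.
  by right; exists f', g'; split=> //; rewrite mem_rcons inE f'fs orbT.
by apply: sub_ideal_gen; right; exists f, g; split=> //; rewrite mem_rcons mem_head.
Qed.

Lemma weak_regP E I L fs : weak_reg E I L fs <->
  (forall f, f \in fs -> E f) /\
  forall i, (i < size fs)%N -> nzd I (foldl (step I) L (take i fs)) fs`_i.
Proof.
elim: fs L => [|f fs IH] L /=; first by split.
split=> [[Ef nf /IH[Efs nfs]]|[Efs nfs]].
  split=> [g|[|i]]; rewrite ?inE => //=; last exact: nfs.
  by case/orP => [/eqP->|/Efs].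
split; first by apply: Efs; rewrite mem_head.
  exact: (nfs 0%N).
apply/IH; split=> [g gfs|i ifs]; first by apply: Efs; rewrite inE gfs orbT.
exact: (nfs i.+1).
Qed.

Lemma weak_reg_take E I L fs i : weak_reg E I L fs -> weak_reg E I L (take i fs).
Proof. by elim: fs L i => [|f fs IH] L [|i] //= [Ef nf /IH]; split. Qed.

Lemma weak_reg_rcons E I L fs f : weak_reg E I L (rcons fs f) <->
  [/\ weak_reg E I L fs, E f & nzd I (foldl (step I) L fs) f].
Proof.
elim: fs L => [|g fs IH] L /=; first by split=> [[]|[]].
by split=> [[Eg ng /IH[wfs Ef nf]]|[[Eg ng wfs] Ef nf]]; split=> //; apply/IH.
Qed.

(** From f g = l + z w, regularity of z modulo f gives w in L + f I, after which f can be
    cancelled. *)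
Lemma nzd_step I L f z : is_ideal I -> is_ideal L ->
  nzd I L f -> nzd I (step I L f) z -> nzd I (step I L z) f.
Proof.
move=> iI iL nf nz g Ig [l [w [Ll Iw e]]].
have /(nz w Iw) [l2 [v [Ll2 Iv wE]]] : step I L f (z * w).
  exists (- l), g; split=> //; last by rewrite e; ring.
  by rewrite -sub0r; apply: idealB => //; exact: ideal0.
exists (g - z * v), v; split=> //; last by ring.
apply: nf; first by apply: idealB => //; exact: idealM.
have -> : f * (g - z * v) = l + z * l2.
  by rewrite mulrBr e wE; ring.
by apply: idealD => //; exact: idealM.
Qed.

Lemma weak_reg_step E I L fs z : is_ideal I -> is_ideal L -> weak_reg E I L fs ->
  (forall i, (i <= size fs)%N -> nzd I (foldl (step I) L (take i fs)) z) ->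
  weak_reg E I (step I L z) fs.
Proof.
move=> iI; elim: fs L => //= f fs IH L iL [Ef nf wfs] nz; split=> //.
  by apply: nzd_step => //; have := nz 1%N isT; rewrite /= take0.
rewrite stepC; apply: IH => // [|i ifs]; first exact: is_ideal_step.
exact: (nz i.+1).
Qed.

(** A socle element u modulo f is sent to the v with z u = f v in M. Cancelling z shows that v is
    nonzero modulo z, and cancelling f that [E] kills v modulo z. This is the comparison of both
    socles with Ext^1, made explicit. *)
Lemma socle_exchange E I L f z : is_ideal I -> is_ideal L -> E z ->
  nzd I L f -> nzd I L z -> has_socle E I (step I L f) -> has_socle E I (step I L z).
Proof.
move=> iI iL Ez nf nz [u [Iu Lu] Eu].
have [l [v [Ll Iv zu]]] := Eu z Ez.
exists v.
  split=> // -[l2 [w [Ll2 Iw vE]]]; apply: Lu.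
  exists (u - f * w), w; split=> //; last by ring.
  apply: nz; first by apply: idealB => //; exact: idealM.
  have -> : z * (u - f * w) = l + f * l2 by rewrite mulrBr zu vE; ring.
  by apply: idealD => //; exact: idealM.
move=> e /Eu [l3 [w [Ll3 Iw eu]]].
exists (e * v - z * w), w; split=> //; last by ring.
apply: nf; first by apply: idealB => //; exact: idealM.
have -> : f * (e * v - z * w) = z * l3 - e * l.
  transitivity (e * (f * v) - z * (f * w)); first by ring.
  have -> : f * v = z * u - l by rewrite zu; ring.
  have -> : f * w = e * u - l3 by rewrite eu; ring.
  by ring.
by apply: idealB => //; exact: idealM.
Qed.

Lemma nzd_socle E I L f : E f -> nzd I L f -> ~ has_socle E I L.
Proof. by move=> Ef nf [u [Iu Lu] Eu]; exact/Lu/nf/Eu. Qed.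

(** * Associated primes and prime avoidance *)

Definition noetherian : Prop := forall C : set (set R), C !=set0 ->
  C `<=` @is_ideal R ->
  exists2 L, C L & forall L', C L' -> L `<=` L' -> L' `<=` L.

Definition is_prime (P : set R) : Prop :=
  ~ P 1 /\ forall f g, P (f * g) -> P f \/ P g.

Definition colon L u : set R := [set f | L (f * u)].

Lemma is_ideal_colon L u : is_ideal L -> is_ideal (colon L u).
Proof.
move=> iL; split=> [|f g Lf Lg|a f Lf]; rewrite /colon /=.
- by rewrite mul0r; exact: ideal0.
- by rewrite mulrDl; exact: idealD.
- by rewrite -mulrA; exact: idealM.
Qed.

(** [colon L u] is the annihilator of the class of u; the maximal ones among annihilators of nonzero
    elements of I/L are associated primes. *)
Definition max_colon I L u : Prop :=
  (I u /\ ~ L u) /\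
  forall v, I v -> ~ L v -> colon L u `<=` colon L v -> colon L v `<=` colon L u.

(** If f g kills u and g u is nonzero, the annihilator of g u contains that of u, hence equals it,
    and it contains f. *)
Lemma max_colon_prime I L u :
  is_ideal I -> is_ideal L -> max_colon I L u -> is_prime (colon L u).
Proof.
move=> iI iL [[Iu Lu] mu]; split; first by rewrite /colon /= mul1r.
move=> f g fg; have [Lg|Lg] := pselect (L (g * u)); [by right|left].
apply: (mu (g * u)) => //; first exact: idealM.
  by move=> a; rewrite /colon /= mulrCA => La; exact: idealM.
by rewrite /colon /= mulrA.
Qed.

Lemma prime_prod P (T : Type) (r : seq T) (Q : pred T) (F : T -> R) :
  is_prime P -> (forall i, Q i -> ~ P (F i)) -> ~ P (\prod_(i <- r | Q i) F i).
Proof.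
move=> [P1 PM] PF; elim/big_rec: _ => // i x Qi Px /PM[]//; exact: PF.
Qed.

(** The u's are chosen so that the ideal N which they generate over L is maximal. A zero divisor f
    lies in some maximal annihilator, of v say. Then v is in N, and this forces the annihilator of v
    to be that of some u_i. *)
Lemma associated_primes I L : noetherian -> is_ideal I -> is_ideal L ->
  exists k (u : 'I_k -> R), (forall i, max_colon I L (u i)) /\
    forall f, (forall i, ~ colon L (u i) f) -> nzd I L f.
Proof.
move=> noeth iI iL.
pose C := [set N | exists k (u : 'I_k -> R), (forall i, max_colon I L (u i)) /\
  N = [set f | exists l (c : 'I_k -> R), L l /\ f = l + \sum_i c i * u i]].
have [||N [k [u [mu NE]]] maxN] := noeth C.
- exists [set f | exists l (c : 'I_0 -> R), L l /\ f = l + \sum_i c i * (fun=> 0) i].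
  by exists 0%N, (fun=> 0); split=> // -[].
- move=> _ [k [u [_ ->]]]; split.
  + exists 0, (fun=> 0); split; first exact: ideal0.
    by rewrite big1 ?addr0// => i _; rewrite mul0r.
  + move=> _ _ [l [c [Ll ->]]] [l' [c' [Ll' ->]]].
    exists (l + l'), (fun i => c i + c' i); split; first exact: idealD.
    under [in RHS]eq_bigr do rewrite mulrDl.
    by rewrite big_split /=; ring.
  + move=> a _ [l [c [Ll ->]]].
    exists (a * l), (fun i => a * c i); split; first exact: idealM.
    by rewrite mulrDr mulr_sumr; congr (_ + _); apply: eq_bigr => i _; ring.
exists k, u; split=> // f nf g Ig Lfg; apply: contrapT => Lg.
have [||_ [v [[Iv Lv] gv <-]] mv] := noeth
  [set colon L v | v in [set v | (I v /\ ~ L v) /\ colon L g `<=` colon L v]].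
- by exists (colon L g); exists g => //; split.
- by move=> _ [v _ <-]; exact: is_ideal_colon.
have mcv : max_colon I L v.
  split=> // w Iw Lw vw; apply: mv => //; exists w => //; split=> //.
  exact: subset_trans vw.
(* Adjoining v to the u's gives an ideal of the same family that contains N. *)
have Nv : N v.
  pose u' i := if unlift ord0 i is Some i' then u i' else v.
  have mu' i : max_colon I L (u' i) by rewrite /u'; case: unliftP.
  apply: (maxN [set f | exists l (c : 'I_k.+1 -> R),
                         L l /\ f = l + \sum_i c i * u' i]).
  - by exists k.+1, u'.
  - rewrite NE => _ [l [c [Ll ->]]].
    exists l, (fun i => if unlift ord0 i is Some i' then c i' else 0); split=> //.
    rewrite big_ord_recl unlift_none mul0r add0r; congr (_ + _).
    by apply: eq_bigr => i _; rewrite /u' liftK.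
  - exists 0, (fun i => if i == ord0 then 1 else 0); split; first exact: ideal0.
    rewrite big_ord_recl /u' unlift_none eqxx mul1r add0r big1 ?addr0// => i _.
    by rewrite mul0r.
have pv := max_colon_prime iI iL mcv.
(* Otherwise choose a_i killing u_i but not v. Their product kills every combination of the u's
   modulo L, hence v, against primality. *)
have [i iv] : exists i, colon L (u i) `<=` colon L v.
  apply: contrapT => no.
  have /choice[a aP] : forall i, exists a, colon L (u i) a /\ ~ colon L v a.
    move=> i; apply: contrapT => na; apply: no; exists i => a ua.
    by apply: contrapT => va; apply: na; exists a.
  apply: (@prime_prod _ _ (index_enum 'I_k) xpredT a pv) => [i _|].
    by have [] := aP i.
  move: Nv; rewrite NE => -[l [c [Ll vE]]].
  rewrite /colon /= vE mulrDr; apply: (@idealD L) => //; first exact: idealM.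
  rewrite mulr_sumr; apply: ideal_sum => // i _.
  have [ai _] := aP i; rewrite (bigD1 i)//=.
  set b := \prod_(_ | _) _.
  have -> : a i * b * (c i * u i) = b * c i * (a i * u i) by ring.
  exact: idealM.
have [_ mui] := mu i; apply: (nf i); apply: (mui v) => //.
exact: (gv f).
Qed.

(** [E] is only closed under sums and products, so that the lemma applies to [x_free_max]. With w_i
    in P_i and in no other prime, w_0 plus a multiple of the product of the other w_i avoids all of
    them. *)
Lemma prime_avoidance E k (P : 'I_k -> set R) :
  E !=set0 ->
  (forall f g, E f -> E g -> E (f + g)) -> (forall f g, E f -> E g -> E (f * g)) ->
  (forall i, is_ideal (P i)) -> (forall i, is_prime (P i)) ->
  (forall i, ~ (E `<=` P i)) -> exists2 z, E z & forall i, ~ P i z.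
Proof.
move=> [e0 Ee0] ED EM; elim: k P => [|k IH] P iP pP nE; first by exists e0 => // -[].
apply: contrapT => nz.
have /choice[w wP] : forall i, exists w, [/\ E w, P i w & forall j, j != i -> ~ P j w].
  move=> i; have [|||z Ez nPz] := IH (fun l => P (lift i l)).
  - by move=> l; exact: iP.
  - by move=> l; exact: pP.
  - by move=> l; exact: nE.
  have nPj j : j != i -> ~ P j z.
    by rewrite eq_sym => /unlift_some[l -> _].
  exists z; split=> //; apply: contrapT => Pz; apply: nz; exists z => // j.
  by have [->//|] := eqVneq j i; exact: nPj.
(* The factor e keeps the product in [E] even when it is empty, and lies outside P_0. *)
have /existsNP[e /not_implyP[Ee Pe]] := nE ord0.
have Eprod r : E (e * \prod_(i <- r | i != ord0) w i).
  elim/big_rec: _ => [|i x _ Ex]; first by rewrite mulr1.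
  by rewrite mulrCA; apply: EM => //; have [] := wP i.
apply: nz; exists (w ord0 + e * \prod_(i | i != ord0) w i).
  by apply: ED => //; have [] := wP ord0.
move=> i; have [->|i0] := eqVneq i ord0 => Psum.
  have [_ P0 _] := wP ord0.
  have := idealB (iP ord0) Psum P0; rewrite addrC addKr => /(pP ord0).2[//|].
  apply: prime_prod => // l l0; have [_ _] := wP l; apply; by rewrite eq_sym.
have [_ _ /(_ i i0) nP] := wP ord0; apply: nP.
have Pw : P i (e * \prod_(i | i != ord0) w i).
  rewrite (bigD1 i)//= mulrCA mulrC; apply: idealM => //.
  by have [] := wP i.
by have := idealB (iP i) Psum Pw; rewrite addrK.
Qed.

(** Prime avoidance is applied to the associated primes of all the quotients at once. If one of them
    contained [E], the element that it annihilates would be a socle element. *)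
Lemma common_nzd E I k (L : 'I_k -> set R) :
  noetherian -> is_ideal I -> (forall i, is_ideal (L i)) -> E !=set0 ->
  (forall f g, E f -> E g -> E (f + g)) -> (forall f g, E f -> E g -> E (f * g)) ->
  (forall i, ~ has_socle E I (L i)) ->
  exists2 z, E z & forall i, nzd I (L i) z.
Proof.
move=> noeth iI iL E0 ED EM ns.
have [t [P [iP pP EP PL]]] : exists t (P : 'I_t -> set R),
    [/\ forall l, is_ideal (P l), forall l, is_prime (P l),
        forall l, ~ (E `<=` P l)
      & forall f, (forall l, ~ P l f) -> forall i, nzd I (L i) f].
  elim: k L iL ns => [|k IH] L iL ns.
    by exists 0%N, (fun=> setT); split=> [[]|[]|[]|f _ []].
  have [||t [P [iP pP EP PL]]] := IH (fun i => L (lift ord0 i)).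
  - by move=> i; exact: iL.
  - by move=> i; exact: ns.
  have [s [u [mu uL]]] := associated_primes noeth iI (iL ord0).
  exists (s + t)%N, (fun l => match split l with
    | inl l' => colon (L ord0) (u l') | inr l' => P l' end).
  split=> [l|l|l|f nf i].
  - by case: split => l' //; exact: is_ideal_colon.
  - by case: split => l' //; apply: max_colon_prime (mu l').
  - case: split => l' // Eu; apply: (ns ord0); have [uI _] := mu l'.
    by exists (u l').
  - case: (unliftP ord0 i) => [i' ->|->].
      apply: PL => l; have := nf (rshift s l).
      by rewrite (unsplitK (inr l)).
    apply: uL => l; have := nf (lshift t l).
    by rewrite (unsplitK (inl l)).
have [z Ez nz] := prime_avoidance E0 ED EM iP pP EP.
by exists z => // i; exact: PL.
Qed.

(** The core of Rees' theorem, by induction on the length: the last members f and g are both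
    exchanged for a common z that is regular on all earlier quotients, and z is then moved to the
    front. *)
Lemma socle_weak_reg E I L fs gs : noetherian -> is_ideal I -> is_ideal L ->
  is_ideal E -> size fs = size gs ->
  weak_reg E I L fs -> weak_reg E I L gs ->
  has_socle E I (foldl (step I) L fs) -> has_socle E I (foldl (step I) L gs).
Proof.
move=> noeth iI iL iE.
elim/last_ind: fs gs L iL => [|fs f IH] gs L iL; first by case: gs.
case/lastP: gs => [|gs g]; rewrite !size_rcons // => -[sfg] wf wg.
(* A proper initial segment leaves a quotient without socle, because the next member is regular on
   it. *)
have nsoc hs i : weak_reg E I L hs -> (i < size hs)%N ->
    ~ has_socle E I (foldl (step I) L (take i hs)).
  move=> /weak_regP[Ehs nhs] ihs; apply: nzd_socle (nhs i ihs).
  exact/Ehs/mem_nth.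
pose M hs (i : 'I_(size gs).+1) := foldl (step I) L (take i hs).
pose Ls (l : 'I_((size gs).+1 + (size gs).+1)) :=
  match split l with inl i => M (rcons fs f) i | inr i => M (rcons gs g) i end.
have [|||||z Ez nz] := @common_nzd E I _ Ls noeth iI.
- by move=> l; rewrite /Ls; case: split => i; exact: is_ideal_steps.
- by exists 0; exact: ideal0.
- by move=> a b; exact: idealD.
- by move=> a b _; exact: idealM.
- by move=> l; rewrite /Ls; case: split => i; apply: nsoc => //; rewrite size_rcons ?sfg.
have nzf i : (i <= size fs)%N -> nzd I (foldl (step I) L (take i fs)) z.
  move=> ifs; have i' : (i < (size gs).+1)%N by rewrite -sfg.
  have := nz (lshift _ (Ordinal i')); rewrite /Ls (unsplitK (inl _)) /M /=.
  by rewrite -cats1 takel_cat.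
have nzg i : (i <= size gs)%N -> nzd I (foldl (step I) L (take i gs)) z.
  move=> ifs; have i' : (i < (size gs).+1)%N by [].
  have := nz (rshift _ (Ordinal i')); rewrite /Ls (unsplitK (inr _)) /M /=.
  by rewrite -cats1 takel_cat.
have [wfs Ef nf] := (weak_reg_rcons _ _ _ _ _).1 wf.
have [wgs Eg ng] := (weak_reg_rcons _ _ _ _ _).1 wg.
rewrite !foldl_rcons => soc.
(* It suffices to find a socle modulo [gs] and z. With z in front, the induction hypothesis over
   M/zM reduces this to [fs] and z, where f is exchanged for z. *)
apply: (@socle_exchange E I _ z) => //; first exact: is_ideal_steps.
  by have := nzg (size gs) (leqnn _); rewrite take_size.
rewrite -steps_step; apply: (IH gs); rewrite ?steps_step//.
- exact: is_ideal_step.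
- exact: weak_reg_step.
- exact: weak_reg_step.
have nzf' : nzd I (foldl (step I) L fs) z.
  by have := nzf (size fs) (leqnn _); rewrite take_size.
by apply: (@socle_exchange E I _ f) => //; exact: is_ideal_steps.
Qed.

(** A longer regular sequence would have an initial segment of the length of [fs]; its quotient
    would have a socle as well as a regular element. The socle also shows that the quotient by [fs]
    is nonzero. *)
Lemma depth_eq_size E I L fs : noetherian -> is_ideal I -> is_ideal L ->
  is_ideal E -> weak_reg E I L fs ->
  has_socle E I (foldl (step I) L fs) -> depth E I L = size fs.
Proof.
move=> noeth iI iL iE wfs soc.
have regE hs : regular_seq E I L hs <->
    weak_reg E I L hs /\ foldl (step I) L hs <> I.
  split=> [[Eh nh]|[/weak_regP[Eh nh]]]; rewrite -ideal_stepE// => neI.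
    split=> //; apply/weak_regP; split=> // i ih.
    by rewrite -ideal_stepE//; exact: nh.
  by split=> // i ih; rewrite !ideal_stepE//; exact: nh.
have rfs : [set size hs | hs in regular_seq E I L] (size fs).
  exists fs => //; apply/regE; split=> // e.
  by have [u [Iu +] _] := soc; rewrite e.
have ub : ubound [set size hs | hs in regular_seq E I L] (size fs).
  move=> _ [hs /regE[whs _] <-]; rewrite leEnat leqNgt; apply/negP => lt.
  have [Eh nh] := (weak_regP _ _ _ _).1 whs.
  apply: (nzd_socle (Eh _ (mem_nth 0 lt)) (nh _ lt)).
  apply: socle_weak_reg soc => //; last exact: weak_reg_take.
  by rewrite size_takel// ltnW.
rewrite /depth /supremum; case: eqP => [e|_]; first by move: rfs; rewrite e.
have sup : supremums [set size hs | hs in regular_seq E I L] (size fs).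
  by split=> // m /(_ _ rfs).
case: xgetP => [m _ [ubm lbm]|/(_ _ sup)//].
by apply/eqP; rewrite eqn_leq -!leEnat lbm// ubm.
Qed.

End Ideals.

(** * Ideals of polynomial rings *)

Section Polynomials.
Variables (n : nat) (K : fieldType).
Local Notation S := {mpoly K[n]}.
Implicit Types (I J L : set S) (m w : 'X_{1..n}) (f g u z : S).

Lemma idealZ L (c : K) f : is_ideal L -> L f -> L (c *: f).
Proof. by move=> iL Lf; rewrite -mul_mpolyC; exact: idealM. Qed.

(** Division with remainder: a multiple of g with the leading term of f is subtracted from f, and
    well-founded induction on leading monomials applies. *)
Lemma sub_of_mlead L L' : is_ideal L -> is_ideal L' -> L `<=` L' ->
  (forall f, L' f -> f != 0 -> exists g, [/\ L g, g != 0 & (mlead g <= mlead f)%MM]) ->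
  L' `<=` L.
Proof.
move=> iL iL' LL' lead f; elim/mleadrect: f => f IH L'f.
have [->|f0] := eqVneq f 0; first exact: ideal0.
have [g [Lg g0 gf]] := lead f L'f f0.
pose h := (mleadc f / mleadc g) *: ('X_[mlead f - mlead g] * g).
have Lh : L h by apply: idealZ => //; exact: idealM.
have X0 : 'X_[mlead f - mlead g] != 0 :> S.
  by rewrite -msupp_eq0 msuppX.
have lh : mlead ('X_[mlead f - mlead g] * g) = mlead f.
  by rewrite mleadM// mleadXm submK.
have ch : h@_(mlead f) = mleadc f.
  have lc : ('X_[mlead f - mlead g] * g)@_(mlead f) = mleadc g.
    transitivity (mleadc ('X_[mlead f - mlead g] * g)); first by rewrite lh.
    by rewrite mleadM// mleadcM mleadXm mcoeffX eqxx mul1r.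
  by rewrite /h mcoeffZ lc divfK// mleadc_eq0.
rewrite -(subrK h f); apply: idealD => //.
have [->|fh0] := eqVneq (f - h) 0; first exact: ideal0.
apply: IH; last by apply: idealB => //; exact: LL'.
rewrite lt_neqAle; apply/andP; split; last first.
  have := mleadB_le f h; rewrite leNgt [in X in _ -> X]leNgt; apply: contra => lt.
  rewrite joinEtotal gt_max lt /=.
  by apply: le_lt_trans lt; rewrite /h; apply: le_trans (mleadZ_le _ _) _; rewrite lh.
apply/eqP => e; have : mleadc (f - h) != 0 by rewrite mleadc_eq0.
by rewrite e mcoeffB ch subrr eqxx.
Qed.

(** Hilbert's basis theorem through Dickson's lemma, applied to the leading exponents that occur
    along a strictly increasing chain of ideals. *)
Lemma mpoly_noetherian : noetherian S.
Proof.
move=> C [L0 CL0] iC; apply: contrapT => nomax.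
have /choice[next nextP] : forall L, exists L', C L ->
    [/\ C L', L `<=` L' & ~ (L' `<=` L)].
  move=> L; have [CL|] := pselect (C L); last by exists L.
  apply: contrapT => nL; apply: nomax; exists L => // L' CL' LL'.
  by apply: contrapT => L'L; apply: nL; exists L'.
pose Ls i := iter i next L0.
have CLs i : C (Ls i) by elim: i => //= i /nextP[].
have Lmono i k : (i <= k)%N -> Ls i `<=` Ls k.
  move=> /subnK <-; elim: (k - i)%N => [|d IH]; first by [].
  by apply: (subset_trans IH); have [] := nextP _ (CLs (d + i)%N).
pose ev m (i : nat) := if insub i is Some i' then m i' else 0%N.
have evE m (i : 'I_n) : ev m i = m i by rewrite /ev valK.
pose B := [set b | exists i f, [/\ Ls i f, f != 0 & b = ev (mlead f)]].
have [s sB sP] := dickson n B.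
(* Each of the finitely many Dickson exponents occurs at some stage of the chain; N bounds these
   stages. *)
have [N NP] : exists N, forall a, List.In a s ->
    exists f, [/\ Ls N f, f != 0 & a = ev (mlead f)].
  elim: s sB {sP} => [|a s IH] sB; first by exists 0%N.
  have [N NP] := IH (fun b sb => sB b (or_intror sb)).
  have [i [f [Lf f0 ae]]] := sB a (or_introl erefl).
  exists (maxn i N) => b [<-|/NP[g [Lg g0 be]]].
    by exists f; split=> //; apply: Lmono Lf; exact: leq_maxl.
  by exists g; split=> //; apply: Lmono Lg; exact: leq_maxr.
have [_ LN nLN] := nextP _ (CLs N); apply: nLN.
apply: sub_of_mlead => //; [exact/iC|exact: iC (CLs N.+1)|].
move=> f Lf f0; have [|a sa af] := sP (ev (mlead f)); first by exists N.+1, f.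
have [g [Lg g0 ae]] := NP a sa; exists g; split=> //.
by apply/mnm_lepP => i; rewrite -!evE -ae; exact: af.
Qed.

Lemma is_ideal_mon I : is_mon_ideal I -> is_ideal I.
Proof. by case=> A ->; exact: is_ideal_gen. Qed.

Lemma mon_ideal_supp I f : is_mon_ideal I ->
  I f <-> forall m, m \in msupp f -> I 'X_[m].
Proof.
move=> [A ->]; rewrite mon_idealP.
by split=> fA m /fA; rewrite mon_idealX.
Qed.

Lemma is_ideal_max : is_ideal (graded_max n K).
Proof. exact: is_ideal_gen. Qed.

Lemma max_supp f : (forall m, m \in msupp f -> m != 0%MM) -> graded_max n K f.
Proof.
move=> fm; rewrite (mpolyE f) big_seq; apply: ideal_sum => [|m /fm m0].
  exact: is_ideal_max.
apply: (@idealZ (graded_max n K)); first exact: is_ideal_max.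
have [i mi] : exists i, m i != 0%N.
  apply/existsP; apply: contraNT m0 => /existsPn m0; apply/eqP/mnmP => i.
  by rewrite mnm0E; apply/eqP; have := m0 i; rewrite negbK.
have Um : (U_(i) <= m)%MM by rewrite lep1mP.
rewrite -(submK Um) mpolyXD.
apply: (@idealM _ (graded_max n K)); first exact: is_ideal_max.
by apply: sub_ideal_gen; exists i.
Qed.


(** N is J + m I, described by monomials. A monomial of least degree in I outside J is not in N,
    since dividing it by a variable would give a smaller one. This keeps I/J nonzero modulo
    sequences in m. *)
Lemma monomial_nakayama I J : is_mon_ideal I -> is_mon_ideal J -> J `<` I ->
  exists2 N, is_ideal N & [/\ J `<=` N, ~ (I `<=` N) &
    forall a g, graded_max n K a -> I g -> N (a * g)].
Proof.
move=> mI mJ [JI nIJ].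
have iI := is_ideal_mon mI; have iJ := is_ideal_mon mJ.
have [m [Im Jm minm]] : exists m, [/\ I 'X_[m], ~ J 'X_[m] &
    forall w, I 'X_[w] -> ~ J 'X_[w] -> (mdeg m <= mdeg w)%N].
  have [f If Jf] : exists2 f, I f & ~ J f.
    by apply: contrapT => H; apply: nIJ => f If; apply: contrapT => Jf; apply: H; exists f.
  have [m0 [Im0 Jm0]] : exists m, I 'X_[m] /\ ~ J 'X_[m].
    apply: contrapT => H; apply: Jf; apply/(mon_ideal_supp _ mJ) => m mf.
    apply: contrapT => Jm; apply: H; exists m; split=> //.
    exact: (mon_ideal_supp _ mI).1 If _ mf.
  have ex : exists k, `[< exists m, [/\ I 'X_[m], ~ J 'X_[m] & mdeg m = k] >].
    by exists (mdeg m0); apply/asboolP; exists m0.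
  case: (ex_minnP ex) => k /asboolP[m [Im Jm <-]] mk.
  by exists m; split=> // w Iw Jw; apply: mk; apply/asboolP; exists w.
pose N : set S := [set f | forall w, w \in msupp f ->
  J 'X_[w] \/ exists2 i, (U_(i) <= w)%MM & I 'X_[w - U_(i)]].
have iN : is_ideal N.
  split=> [w|f g Nf Ng w|a f Nf w]; first by rewrite msupp0.
    by move/msuppD_le; rewrite mem_cat => /orP[/Nf|/Ng].
  move/msuppM_le/allpairsP => [[v1 v2] /= [_ /Nf[Jv|[i iv Iv]] ->]].
    by left; rewrite mpolyXD; exact: idealM.
  right; exists i; first by rewrite (lepm_trans iv)// lem_addl.
  by rewrite -addmBA// mpolyXD; exact: idealM.
exists N => //; split.
- move=> f Jf w wf; left; exact: (mon_ideal_supp _ mJ).1 Jf _ wf.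
- move=> /(_ 'X_[m] Im m); rewrite msuppX mem_head => -[]// [i im Imi].
  have := minm _ Imi; case: (pselect (J 'X_[m - U_(i)])) => [Jmi|nJ /(_ nJ)].
    by case: Jm; rewrite -(submK im) mpolyXD mulrC; exact: idealM.
  by rewrite -[in X in (X <= _)%N](submK im) mdegD mdeg1 addn1 ltnn.
- move=> a g ma Ig; move: a ma.
  apply: (@ideal_gen_sub _ _ [set a | N (a * g)]).
    exact: is_ideal_colon.
  move=> _ [i _ <-] w; rewrite mulrC (perm_mem (msuppMX _ _)).
  move=> /mapP[v vg ->]; right; exists i; first by rewrite lem_addr.
  by rewrite addmC addmK; exact: (mon_ideal_supp _ mI).1 Ig _ vg.
Qed.

End Polynomials.

(** * The grading by one variable *)

Section Grading.
Variables (n : nat) (K : fieldType) (j : 'I_n).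
Local Notation S := {mpoly K[n]}.
Local Notation x := ('X_j : S).
Implicit Types (I J L : set S) (m w : 'X_{1..n}) (f g u z : S).

Definition x_free : set S := [set f | forall m, m \in msupp f -> m j = 0%N].

(** The coefficients stay in S instead of a ring in n - 1 variables; that they do not involve x is
    expressed by [x_free]. *)
Definition to_poly : S -> {poly S} :=
  mmap (@polyC S \o @mpolyC n K) (fun i => if i == j then 'X else ('X_i)%:P).

(* f = \sum_a x^a * coefx a f, with x-free coefficients. *)
Definition coefx (a : nat) f : S := (to_poly f)`_a.

Lemma lem_xpart m : (U_(j) *+ m j <= m)%MM.
Proof.
by apply/mnm_lepP => i; rewrite mulmnE mnm1E; case: eqP => [->|_]; rewrite ?mul1n ?mul0n.
Qed.

Lemma to_polyX m :
  to_poly 'X_[m] = ('X_[m - U_(j) *+ m j])%:P * 'X^(m j).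
Proof.
rewrite /to_poly mmapX /mmap1 (bigD1 j)//= eqxx mulrC; congr (_ * _).
rewrite (mpolyXE_id K (m - U_(j) *+ m j)) [in RHS](bigD1 j)//= mnmBE mulmnE mnm1E eqxx mul1n subnn expr0 mul1r.
rewrite rmorph_prod /=; apply: eq_bigr => i ij.
rewrite (negPf ij) rmorphXn /= mnmBE mulmnE mnm1E.
by rewrite eq_sym (negPf ij) mul0n subn0.
Qed.

Lemma coefx_sum (T : Type) (r : seq T) (P : pred T) (F : T -> S) a :
  coefx a (\sum_(i <- r | P i) F i) = \sum_(i <- r | P i) coefx a (F i).
Proof. by rewrite /coefx /to_poly rmorph_sum coef_sum. Qed.

Lemma coefxD a f g : coefx a (f + g) = coefx a f + coefx a g.
Proof. by rewrite /coefx /to_poly rmorphD coefD. Qed.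

Lemma coefxZ a (c : K) f : coefx a (c *: f) = c *: coefx a f.
Proof.
rewrite /coefx -mul_mpolyC /to_poly rmorphM /= mmapC /= coefCM.
by rewrite mul_mpolyC.
Qed.

Lemma coefxX a m :
  coefx a 'X_[m] = if m j == a then 'X_[m - U_(j) *+ m j] else 0.
Proof.
rewrite /coefx to_polyX coefCM coefXn eq_sym.
by case: eqP => _; rewrite ?mulr1 ?mulr0.
Qed.

Lemma x_free_sum (T : Type) (r : seq T) (P : pred T) (F : T -> S) :
  (forall i, P i -> x_free (F i)) -> x_free (\sum_(i <- r | P i) F i).
Proof.
move=> xF; elim/big_rec: _ => [|i f Pi xf] m; first by rewrite msupp0.
by move/msuppD_le; rewrite mem_cat => /orP[/(xF i Pi)|/xf].
Qed.

Lemma x_freeZ (c : K) f : x_free f -> x_free (c *: f).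
Proof. by move=> xf m /msuppZ_le; exact: xf. Qed.

Lemma x_freeM f g : x_free f -> x_free g -> x_free (f * g).
Proof.
move=> xf xg m /msuppM_le/allpairsP[[v w] /= [/xf v0 /xg w0 ->]].
by rewrite mnmDE v0 w0.
Qed.

Lemma x_free_coefx a f : x_free (coefx a f).
Proof.
rewrite (mpolyE f) coefx_sum; apply: x_free_sum => m _.
rewrite coefxZ coefxX; apply: x_freeZ; case: eqP => _ w; last by rewrite msupp0.
rewrite msuppX inE => /eqP->.
by rewrite mnmBE mulmnE mnm1E eqxx mul1n subnn.
Qed.

Lemma to_poly_x_free z : x_free z -> to_poly z = z%:P.
Proof.
move=> xz; rewrite [in LHS](mpolyE z) [in RHS](mpolyE z) /to_poly !rmorph_sum /=.
rewrite big_seq [RHS]big_seq; apply: eq_bigr => m /xz m0.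
rewrite -mul_mpolyC !rmorphM /= mmapC /=; congr (_ * _).
by rewrite -/(to_poly _) to_polyX m0 mulm0n expr0 mulr1 subm0.
Qed.

Lemma coefxM a z f : x_free z -> coefx a (z * f) = z * coefx a f.
Proof. by move=> /to_poly_x_free; rewrite /coefx /to_poly rmorphM /= => ->; rewrite coefCM. Qed.

Lemma coefx_xM a f : coefx a (x * f) = if a is a'.+1 then coefx a' f else 0.
Proof.
rewrite /coefx /to_poly rmorphM /= mmapX mmap1U eqxx coefXM.
by case: a.
Qed.

Lemma coefx_xXM a b g : x_free g -> coefx a (x ^+ b * g) = if a == b then g else 0.
Proof.
move=> xg; elim: b a => [|b IH] a.
  by rewrite expr0 mul1r /coefx to_poly_x_free// coefC.
by rewrite exprS -mulrA coefx_xM; case: a => // a; rewrite IH eqSS.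
Qed.

Lemma coefxE f : exists N, f = \sum_(a < N) x ^+ a * coefx a f.
Proof.
exists (\max_(m <- msupp f) m j).+1.
set N := _.+1; rewrite {1}(mpolyE f).
transitivity (\sum_(a < N) \sum_(m <- msupp f) x ^+ a * coefx a (f@_m *: 'X_[m])).
  2: by apply: eq_bigr => a _; rewrite [in RHS](mpolyE f) coefx_sum mulr_sumr.
rewrite exchange_big /= big_seq [RHS]big_seq; apply: eq_bigr => m mf.
have mN : (m j < N)%N by rewrite ltnS; exact: (leq_bigmax_seq (F := fun m : 'X_{1..n} => m j) m).
rewrite (bigD1 (Ordinal mN))//= big1 ?addr0 => [|a]; last first.
  move=> /eqP aN; rewrite coefxZ coefxX; case: eqP => [e|_].
    by case: aN; apply: val_inj; rewrite /= e.
  by rewrite scaler0 mulr0.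
rewrite coefxZ coefxX eqxx -scalerAr; congr (_ *: _).
rewrite mpolyXn -mpolyXD addmC submK//.
exact: lem_xpart.
Qed.

Definition x_graded L : Prop := forall f, L f -> forall a, L (x ^+ a * coefx a f).

Lemma x_gradedP L f : is_ideal L -> (forall a, L (x ^+ a * coefx a f)) -> L f.
Proof. by move=> iL Lf; have [N ->] := coefxE f; apply: ideal_sum. Qed.

Lemma x_graded_mon I : is_mon_ideal I -> x_graded I.
Proof.
move=> mI f /(mon_ideal_supp _ mI) If a; have iI := is_ideal_mon mI.
rewrite (mpolyE f) coefx_sum mulr_sumr big_seq; apply: ideal_sum => // m mf.
rewrite coefxZ -scalerAr; apply: idealZ => //; rewrite coefxX.
case: eqP => [<-|_]; last by rewrite mulr0; exact: ideal0.
rewrite mpolyXn -mpolyXD addmC submK; first exact: If.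
exact: lem_xpart.
Qed.

Lemma x_graded_step I L z :
  x_free z -> x_graded I -> x_graded L -> x_graded (step I L z).
Proof.
move=> xz gI gL _ [l [g [Ll Ig ->]]] a.
exists (x ^+ a * coefx a l), (x ^+ a * coefx a g); split; [exact: gL|exact: gI|].
by rewrite coefxD coefxM// mulrDr mulrCA.
Qed.

(** Applied to numerators and denominators alike, this identifies M_a with M'_b as modules over the
    polynomials without x. *)
Definition same_piece a b L L' : Prop :=
  forall g, x_free g -> L (x ^+ a * g) <-> L' (x ^+ b * g).

Lemma same_piece_sym a b L L' : same_piece a b L L' -> same_piece b a L' L.
Proof. by move=> e g xg; rewrite e. Qed.

(** As z is x-free, an equation h = l + z g can be read off in a single x-degree. *)
Lemma same_piece_step a b I L I' L' z : x_free z ->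
  x_graded I -> x_graded L -> x_graded I' -> x_graded L' ->
  same_piece a b I I' -> same_piece a b L L' ->
  same_piece a b (step I L z) (step I' L' z).
Proof.
move=> xz.
have half c d I0 L0 I1 L1 : x_graded I0 -> x_graded L0 ->
    same_piece c d I0 I1 -> same_piece c d L0 L1 ->
    forall g, x_free g -> step I0 L0 z (x ^+ c * g) -> step I1 L1 z (x ^+ d * g).
  move=> gI gL eI eL g xg [l [h [Ll Ih e]]].
  exists (x ^+ d * coefx c l), (x ^+ d * coefx c h); split.
  - by apply/eL; [exact: x_free_coefx|exact: gL].
  - by apply/eI; [exact: x_free_coefx|exact: gI].
  have := congr1 (coefx c) e; rewrite coefx_xXM// eqxx coefxD coefxM// => ->.
  by rewrite mulrDr mulrCA.
move=> gI gL gI' gL' eI eL g xg; split; first exact: half.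
by apply: half => //; exact: same_piece_sym.
Qed.

(* Degree a of M = I/L is degree b of M' = I'/L'; the multiplication by x out of
   it is the one of M', or an isomorphism. *)
Definition half_sim I L I' L' : Prop := forall a, exists b,
  [/\ same_piece a b I I', same_piece a b L L' &
      (same_piece a.+1 b.+1 I I' /\ same_piece a.+1 b.+1 L L') \/
      (same_piece a.+1 b I I' /\ same_piece a.+1 b L L')].

Definition sim I L I' L' : Prop := half_sim I L I' L' /\ half_sim I' L' I L.

Lemma sim_sym I L I' L' : sim I L I' L' -> sim I' L' I L.
Proof. by case. Qed.

Lemma sim_swap I L I' L' : sim I L I' L' -> sim L I L' I'.
Proof.
have half I0 L0 I1 L1 : half_sim I0 L0 I1 L1 -> half_sim L0 I0 L1 I1.
  move=> h a; have [b [eI eL e]] := h a; exists b; split=> //.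
  by case: e => -[eI1 eL1]; [left|right].
by case=> h h'; split; exact: half.
Qed.

Lemma sim_step I L I' L' z : x_free z ->
  x_graded I -> x_graded L -> x_graded I' -> x_graded L' ->
  sim I L I' L' -> sim I (step I L z) I' (step I' L' z).
Proof.
move=> xz.
have half I0 L0 I1 L1 : x_graded I0 -> x_graded L0 -> x_graded I1 -> x_graded L1 ->
    half_sim I0 L0 I1 L1 -> half_sim I0 (step I0 L0 z) I1 (step I1 L1 z).
  move=> gI gL gI' gL' h a; have [b [eI eL e]] := h a; exists b.
  split=> //; first exact: same_piece_step.
  by case: e => -[eI1 eL1]; [left|right]; split=> //; exact: same_piece_step.
by move=> gI gL gI' gL' [h1 h2]; split; exact: half.
Qed.

Lemma sim_sub I L I' L' : x_graded I' -> is_ideal L' ->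
  sim I L I' L' -> I `<=` L -> I' `<=` L'.
Proof.
move=> gI' iL' [_ h] IL f I'f; apply: x_gradedP => // b.
have [a [eI eL _]] := h b; have xf := @x_free_coefx b f.
by apply/(eL _ xf)/IL/(eI _ xf)/gI'.
Qed.

Lemma sim_nzd I L I' L' z : x_free z -> x_graded I' -> x_graded L' -> is_ideal L' ->
  sim I L I' L' -> nzd I L z -> nzd I' L' z.
Proof.
move=> xz gI' gL' iL' [_ h] nz g I'g L'zg; apply: x_gradedP => // b.
have [a [eI eL _]] := h b; have xg := @x_free_coefx b g.
apply/(eL _ xg)/nz; first exact/(eI _ xg)/gI'.
rewrite mulrCA; apply/eL; first exact: x_freeM.
by rewrite -(coefxM b g xz); exact: gL'.
Qed.

(** The graded maximal ideal of the subring of polynomials without x, seen inside S. *)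
Definition x_free_max : set S :=
  [set f | forall m, m \in msupp f -> m j = 0%N /\ m != 0%MM].

Lemma x_free_max_free f : x_free_max f -> x_free f.
Proof. by move=> fm m /fm[]. Qed.

Lemma x_free_max_max f : x_free_max f -> graded_max n K f.
Proof. by move=> fm; apply: max_supp => m /fm[]. Qed.

Lemma x_free_maxD f g : x_free_max f -> x_free_max g -> x_free_max (f + g).
Proof. by move=> fm gm m /msuppD_le; rewrite mem_cat => /orP[/fm|/gm]. Qed.

Lemma x_free_maxM f g : x_free_max f -> x_free_max g -> x_free_max (f * g).
Proof.
move=> fm gm m /msuppM_le/allpairsP[[v w] /= [/fm[v0 vn] /gm[w0 wn] ->]].
rewrite mnmDE v0 w0; split=> //; rewrite -mdeg_eq0 mdegD addn_eq0 !mdeg_eq0.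
by rewrite (negPf vn).
Qed.

Lemma x_free_maxX i : i != j -> x_free_max 'X_i.
Proof.
move=> ij m; rewrite msuppX inE => /eqP->; rewrite mnm1E (negPf ij); split=> //.
by rewrite -mdeg_eq0 mdeg1.
Qed.

Lemma max_sub_x L : is_ideal L -> L x -> (forall e, x_free_max e -> L e) ->
  graded_max n K `<=` L.
Proof.
move=> iL Lx Le; apply: ideal_gen_sub => // _ [i _ <-].
by have [->//|ij] := eqVneq i j; apply: Le; exact: x_free_maxX.
Qed.

(** A nonzero homogeneous component of a socle element is carried from degree a to degree b. Since x
    kills it, x is not injective out of M_a, which excludes the second alternative of [half_sim]. *)
Lemma sim_socle I L I' L' : is_ideal I -> is_ideal L -> is_ideal I' -> is_ideal L' ->
  x_graded I -> x_graded L ->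
  sim I L I' L' -> has_socle (graded_max n K) I L -> has_socle (graded_max n K) I' L'.
Proof.
move=> iI iL iI' iL' gI gL [h _] [u [Iu Lu] mu].
have [a La] : exists a, ~ L (x ^+ a * coefx a u).
  by apply/existsNP => La; apply: Lu; exact: x_gradedP.
have [b [eI eL e]] := h a; have xu := @x_free_coefx a u.
have Lxa : L (x ^+ a.+1 * coefx a u).
  have /mu/gL/(_ a.+1) : graded_max n K x by apply: sub_ideal_gen; exists j.
  by rewrite coefx_xM.
exists (x ^+ b * coefx a u).
  by split; [apply/(eI _ xu)/gI|move=> /(eL _ xu)].
apply: (@max_sub_x (colon L' (x ^+ b * coefx a u))).
- exact: is_ideal_colon.
- rewrite /colon /= mulrA -exprS; case: e => -[_ eL1]; first exact/(eL1 _ xu).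
  by case: La; apply/(eL _ xu)/(eL1 _ xu).
- move=> f fm; have xf := x_free_max_free fm.
  rewrite /colon /= mulrCA; apply/eL; first exact: x_freeM.
  rewrite -(coefxM a u xf); apply: gL; by apply: mu; exact: x_free_max_max.
Qed.

(* With U = {u in I | E u in L}, every y in m acts on U/L as x * p for some p. *)
Lemma max_acts L y : is_ideal L -> graded_max n K y ->
  exists p, forall u, (forall e, x_free_max e -> L (e * u)) -> L (y * u - x * p * u).
Proof.
move=> iL; move: y.
pose A := [set y : S | exists p, forall u,
  (forall e, x_free_max e -> L (e * u)) -> L (y * u - x * p * u)].
apply: (@max_sub_x A); [split|..].
- by exists 0 => u _; rewrite mulr0 !mul0r subrr; exact: ideal0.
- move=> f g [p fp] [q gq]; exists (p + q) => u Eu.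
  have -> : (f + g) * u - x * (p + q) * u
            = (f * u - x * p * u) + (g * u - x * q * u) by ring.
  by apply: idealD; [|exact: fp|exact: gq].
- move=> c f [p fp]; exists (c * p) => u Eu.
  have -> : c * f * u - x * (c * p) * u = c * (f * u - x * p * u) by ring.
  by apply: idealM => //; exact: fp.
- by exists 1 => u _; rewrite mulr1 subrr; exact: ideal0.
- by move=> e Ee; exists 0 => u Eu; rewrite mulr0 mul0r subr0; exact: Eu.
Qed.

(** The socle element is p u, with u of least x-degree in U outside L. It is killed by x modulo y
    because x p u = y u in M. If it vanished modulo y, p u = y w in M would give u = x w in M with w
    in U, against the choice of u. *)
Lemma socle_of_x_free_socle I L y : is_ideal I -> is_ideal L ->
  x_graded I -> x_graded L -> graded_max n K y -> nzd I L y ->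
  has_socle x_free_max I L -> has_socle (graded_max n K) I (step I L y).
Proof.
move=> iI iL gI gL my ny soc.
pose U u := I u /\ forall e, x_free_max e -> L (e * u).
have gU u a : U u -> U (x ^+ a * coefx a u).
  move=> [Iu Eu]; split; first exact: gI.
  move=> e Ee; rewrite mulrCA -(coefxM a u (x_free_max_free Ee)).
  by apply: gL; exact: Eu.
have [a [g [xg Ug Lg mina]]] : exists a g, [/\ x_free g, U (x ^+ a * g),
    ~ L (x ^+ a * g) &
    forall b h, x_free h -> U (x ^+ b * h) -> ~ L (x ^+ b * h) -> (a <= b)%N].
  have [u [Iu Lu] Eu] := soc.
  have [a0 La0] : exists a, ~ L (x ^+ a * coefx a u).
    by apply/existsNP => La; apply: Lu; exact: x_gradedP.
  have ex : exists a, `[< exists g, [/\ x_free g, U (x ^+ a * g) & ~ L (x ^+ a * g)] >].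
    exists a0; apply/asboolP; exists (coefx a0 u); split=> //; last exact: gU.
    exact: x_free_coefx.
  case: (ex_minnP ex) => a /asboolP[g [xg Ug Lg]] mina.
  exists a, g; split=> // b h xh Uh Lh; apply: mina; apply/asboolP.
  by exists h.
have [p yp] := max_acts iL my.
set u := x ^+ a * g in Ug Lg; have [Iu Eu] := Ug.
have xpu : step I L y (x * (p * u)).
  exists (- (y * u - x * p * u)), u; split=> //; last by ring.
  by rewrite -sub0r; apply: idealB; [|exact: ideal0|exact: yp].
exists (p * u).
  split; first exact: idealM.
  move=> [l [w [Ll Iw e]]].
  (* For x-free e, y e w = p e u = 0 in M, and y can be cancelled. *)
  have Uw : U w.
    split=> // e' Ee'; apply: ny; first exact: idealM.
    have -> : y * (e' * w) = p * (e' * u) - e' * l.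
      by transitivity (e' * (p * u) - e' * l); [rewrite e; ring|ring].
    by apply: idealB => //; apply: idealM => //; exact: Eu.
  have Uxw : L (u - x * w).
    have Ixw : I (u - x * w) by apply: idealB => //; exact: idealM.
    apply: ny => //.
    have -> : y * (u - x * w) = (y * (u - x * w) - x * p * (u - x * w)) +
         (x * (l + (y * w - x * p * w))).
      have -> : x * p * (u - x * w) = x * (p * u) - x * (x * p * w) by ring.
      by rewrite e; ring.
    apply: idealD => //.
      apply: yp => f Ef; rewrite mulrBr; apply: idealB => //; first exact: Eu.
      by rewrite mulrCA; apply: idealM => //; have [_] := Uw; apply.
    by apply: idealM => //; apply: idealD => //; apply: yp; have [] := Uw.
  (* In x-degree a, u equals x times the component of w of degree a - 1, which lies in L by
     minimality of a. For a = 0 there is no such component and u itself lies in L. *)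
  have := gL _ Uxw a; rewrite -[u - x * w]addrC coefxD -mulrN coefx_xM.
  rewrite coefx_xXM// eqxx; case: a @u Ug Lg mina Iu Eu xpu e Uxw
    => [|a] u Ug Lg mina Iu Eu xpu e Uxw.
    by rewrite add0r.
  move=> Lga; have Uh := gU _ a Uw.
  have xh := @x_free_coefx a w.
  have [Lh|/(mina _ _ xh Uh)] := pselect (L (x ^+ a * coefx a w)); last by rewrite ltnn.
  apply: Lg; have -> : u = x ^+ a.+1 * (coefx a (- w) + g) + x * (x ^+ a * coefx a w).
    by rewrite /u -scaleN1r coefxZ scaleN1r exprS; ring.
  by apply: idealD => //; exact: idealM.
apply: (@max_sub_x (colon (step I L y) (p * u))) => //.
  by apply: is_ideal_colon; exact: is_ideal_step.
move=> f Ef; apply: sub_step => //.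
by rewrite mulrCA; apply: idealM => //; exact: Eu.
Qed.

(** * Equality of depths from the degreewise comparison *)

Lemma x_graded_steps I L zs : (forall z, z \in zs -> x_free z) ->
  x_graded I -> x_graded L -> x_graded (foldl (step I) L zs).
Proof.
elim: zs L => //= z zs IH L xzs gI gL; apply: IH => //.
  by move=> f fzs; apply: xzs; rewrite inE fzs orbT.
by apply: x_graded_step => //; apply: xzs; rewrite mem_head.
Qed.

(** [zs] is chosen with J + (zs) I maximal. A further regular z would not enlarge this ideal, so z I
    would lie in it, hence also I by regularity, against Nakayama. *)
Lemma max_weak_reg I J : is_mon_ideal I -> is_mon_ideal J -> J `<` I ->
  exists2 zs, weak_reg x_free_max I J zs &
    forall z, x_free_max z -> ~ nzd I (foldl (step I) J zs) z.
Proof.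
move=> mI mJ JI; have iI := is_ideal_mon mI; have iJ := is_ideal_mon mJ.
have [N iN [JN IN mN]] := monomial_nakayama mI mJ JI.
have [||_ [zs wzs <-] maxz] := @mpoly_noetherian n K
    [set foldl (step I) J zs | zs in weak_reg x_free_max I J].
- by exists J; exists [::].
- by move=> _ [zs _ <-]; exact: is_ideal_steps.
exists zs => // z Ez nz; apply: IN.
have zsN : foldl (step I) J zs `<=` N.
  elim/last_ind: zs wzs {maxz nz} => [|zs f IH]; first by [].
  rewrite weak_reg_rcons foldl_rcons => -[/IH zsN Ef _] _ [l [g [Ll Ig ->]]].
  by apply: idealD => //; [exact: zsN|apply: mN => //; exact: x_free_max_max].
have iL : is_ideal (foldl (step I) J zs) by exact: is_ideal_steps.
have stepL : step I (foldl (step I) J zs) z `<=` foldl (step I) J zs.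
  apply: maxz; last exact: sub_step.
  exists (rcons zs z); last by rewrite foldl_rcons.
  exact/weak_reg_rcons.
by move=> g Ig; apply/zsN/nz => //; apply/stepL/mul_step.
Qed.

Lemma sim_weak_reg I L I' L' zs : is_ideal I -> is_ideal L -> is_ideal I' -> is_ideal L' ->
  x_graded I -> x_graded L -> x_graded I' -> x_graded L' ->
  sim I L I' L' -> weak_reg x_free_max I L zs ->
  weak_reg x_free_max I' L' zs /\
  sim I (foldl (step I) L zs) I' (foldl (step I') L' zs).
Proof.
move=> iI + iI' + gI + gI'.
elim: zs L L' => [|z zs IH] L L' iL iL' gL gL' s //= [Ez nz wzs].
have xz := x_free_max_free Ez.
have [|||||| wzs' s'] := IH (step I L z) (step I' L' z).
- exact: is_ideal_step.
- exact: is_ideal_step.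
- exact: x_graded_step.
- exact: x_graded_step.
- exact: sim_step.
- exact: wzs.
by split=> //; split=> //; exact: (sim_nzd xz _ _ _ s).
Qed.

Lemma weak_reg_sub (E E' : set S) I L zs :
  E `<=` E' -> weak_reg E I L zs -> weak_reg E' I L zs.
Proof. by move=> EE'; elim: zs L => //= z zs IH L [/EE' Ez nz /IH]. Qed.

Lemma not_nzd_socle (E : set S) I L : is_ideal I -> is_ideal L -> E !=set0 ->
  (forall f g, E f -> E g -> E (f + g)) -> (forall f g, E f -> E g -> E (f * g)) ->
  (forall z, E z -> ~ nzd I L z) -> has_socle E I L.
Proof.
move=> iI iL E0 ED EM nz; apply: contrapT => ns.
have [z Ez /(_ ord0) zn] := @common_nzd _ E I 1 (fun=> L) (@mpoly_noetherian n K)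
  iI (fun=> iL) E0 ED EM (fun=> ns).
exact: nz zn.
Qed.

Lemma sim_depth I J I' J' : is_mon_ideal I -> is_mon_ideal J -> J `<` I ->
  is_mon_ideal I' -> is_mon_ideal J' -> sim I J I' J' ->
  depth (graded_max n K) I J = depth (graded_max n K) I' J'.
Proof.
move=> mI mJ JI mI' mJ' s.
have [iI iJ] := (is_ideal_mon mI, is_ideal_mon mJ).
have [iI' iJ'] := (is_ideal_mon mI', is_ideal_mon mJ').
have [gI gJ] := (x_graded_mon mI, x_graded_mon mJ).
have [gI' gJ'] := (x_graded_mon mI', x_graded_mon mJ').
have noeth := @mpoly_noetherian n K.
have im := @is_ideal_max n K.
have [zs wzs nzs] := max_weak_reg mI mJ JI.
have [wzs' s'] := sim_weak_reg iI iJ iI' iJ' gI gJ gI' gJ' s wzs.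
have xzs z : z \in zs -> x_free z.
  by move=> /((weak_regP _ _ _ _).1 wzs).1; exact: x_free_max_free.
move: s' nzs.
set L := foldl _ J zs; set L' := foldl _ J' zs => s' nzs.
have iL : is_ideal L by exact: is_ideal_steps.
have iL' : is_ideal L' by exact: is_ideal_steps.
have gL : x_graded L by exact: x_graded_steps.
have gL' : x_graded L' by exact: x_graded_steps.
have nzs' z : x_free_max z -> ~ nzd I' L' z.
  move=> Ez nz; apply: (nzs z Ez).
  by apply: sim_nzd nz => //; [exact: x_free_max_free|exact: sim_sym].
have E0 : x_free_max !=set0 by exists 0 => m; rewrite msupp0.
(* This claim and the next are stated for an arbitrary pair, since each is applied to I/J and to
   I'/J'. *)
have soc_depth I0 J0 : is_ideal I0 -> is_ideal J0 -> weak_reg x_free_max I0 J0 zs ->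
    has_socle (graded_max n K) I0 (foldl (step I0) J0 zs) ->
    depth (graded_max n K) I0 J0 = size zs.
  move=> iI0 iJ0 w; apply: depth_eq_size => //.
  by apply: (weak_reg_sub _ w) => z; exact: x_free_max_max.
have nosoc_depth I0 J0 : is_ideal I0 -> is_ideal J0 ->
    x_graded I0 -> x_graded J0 -> weak_reg x_free_max I0 J0 zs ->
    (forall z, x_free_max z -> ~ nzd I0 (foldl (step I0) J0 zs) z) ->
    ~ has_socle (graded_max n K) I0 (foldl (step I0) J0 zs) ->
    depth (graded_max n K) I0 J0 = (size zs).+1.
  move=> iI0 iJ0 gI0 gJ0 w nz ns.
  have iL0 : is_ideal (foldl (step I0) J0 zs) by exact: is_ideal_steps.
  have [y my ny] : exists2 y, graded_max n K y & nzd I0 (foldl (step I0) J0 zs) y.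
    apply: contrapT => H; apply: ns; apply: not_nzd_socle => //.
    - by exists 0; exact: (ideal0 im).
    - by move=> f g; exact: (@idealD _ _ _ _ im).
    - by move=> f g _; exact: (@idealM _ _ _ _ im).
    - by move=> z mz nz'; apply: H; exists z.
  rewrite -(size_rcons zs y); apply: depth_eq_size => //.
    by apply/weak_reg_rcons; split=> //; by apply: (weak_reg_sub _ w) => z; exact: x_free_max_max.
  rewrite foldl_rcons; apply: socle_of_x_free_socle => //.
    exact: x_graded_steps.
  (* No x-free element of m is regular modulo [zs], so some nonzero element is killed by all of
     them. *)
  apply: not_nzd_socle => //; [exact: x_free_maxD|exact: x_free_maxM].
have [soc|ns] := pselect (has_socle (graded_max n K) I L).
  rewrite (soc_depth I J)// (soc_depth I' J')//.
  by apply: sim_socle s' soc.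
rewrite (nosoc_depth I J)// (nosoc_depth I' J')// => soc; apply: ns.
by apply: sim_socle soc => //; exact: sim_sym.
Qed.

End Grading.

(** * Canonical forms *)

Section Canonical.
Variables (n : nat) (K : fieldType) (j : 'I_n).
Local Notation S := {mpoly K[n]}.
Implicit Types (I J L : set S) (m w : 'X_{1..n}) (ks : seq nat) (a b k : nat).

Definition rank ks k : nat := if k == 0%N then 0%N else (index k ks).+1.

(** A generator with x-exponent k can divide a monomial of x-degree a exactly when its relabelled
    version can divide one of x-degree b, as far as x is concerned. *)
Definition same_cut ks a b : Prop :=
  forall k, (k == 0%N) || (k \in ks) -> (k <= a)%N = (rank ks k <= b)%N.

Lemma same_cutP ks a b :
  (forall k, k \in ks -> (k <= a)%N = (index k ks < b)%N) -> same_cut ks a b.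
Proof. by move=> H k; rewrite /rank; case: eqP => [->|_ /H]. Qed.

Lemma index_le_nth ks i k : sorted ltn ks -> k \in ks -> (i < size ks)%N ->
  (index k ks <= i)%N = (k <= nth 0%N ks i)%N.
Proof.
move=> sks kks iks; rewrite -[in RHS](nth_index 0%N kks).
have kis : (index k ks < size ks)%N by rewrite index_mem.
by rewrite (leq_mono_in (sorted_ltn_nth ltn_trans 0%N sks)).
Qed.

Lemma index_lt_nth ks i k : sorted ltn ks -> k \in ks -> (i < size ks)%N ->
  (index k ks < i)%N = (k < nth 0%N ks i)%N.
Proof.
move=> sks kks iks; rewrite -[in RHS](nth_index 0%N kks).
have kis : (index k ks < size ks)%N by rewrite index_mem.
by rewrite (leqW_mono_in (leq_mono_in (sorted_ltn_nth ltn_trans 0%N sks))).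
Qed.

Lemma same_cut_right ks a : sorted ltn ks -> exists b,
  same_cut ks a b /\ (same_cut ks a.+1 b.+1 \/ same_cut ks a.+1 b).
Proof.
(* As [ks] is sorted, b is the number of its entries that are at most a. It grows at a + 1 exactly
   when a + 1 is in [ks]. *)
move=> sks; pose b := find (ltn a) ks.
have cut k : k \in ks -> (k <= a)%N = (index k ks < b)%N.
  move=> kks; have kis : (index k ks < size ks)%N by rewrite index_mem.
  have [lt|ge] := ltnP b (size ks).
    have hasa : has (ltn a) ks by rewrite has_find.
    apply/idP/idP => [ka|/(before_find 0%N)].
      by rewrite index_lt_nth//; apply: leq_ltn_trans ka (nth_find 0%N hasa).
    by rewrite nth_index//= ltnNge => /negbFE.
  rewrite (leq_trans kis ge); have /(before_find 0%N) := leq_trans kis ge.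
  by rewrite nth_index//= ltnNge => /negbFE.
exists b; split; first exact: same_cutP.
have [aks|aks] := boolP (a.+1 \in ks); last first.
  right; apply: same_cutP => k kks; rewrite leq_eqVlt ltnS cut//.
  by case: eqP => // e; rewrite -e kks in aks.
left; apply: same_cutP => k kks; rewrite ltnS.
have ba : (b <= index a.+1 ks)%N by rewrite leqNgt -cut// ltnn.
have lt : (b < size ks)%N by rewrite (leq_ltn_trans ba)// index_mem.
have -> : a.+1 = nth 0%N ks b.
  apply/eqP; rewrite eqn_leq; apply/andP; split.
    by apply: (nth_find 0%N); rewrite has_find.
  by rewrite leqNgt -index_lt_nth// -leqNgt.
by rewrite index_le_nth.
Qed.

Lemma same_cut_left ks b : sorted ltn ks -> (forall k, k \in ks -> (0 < k)%N) ->
  exists a, same_cut ks a b /\ (same_cut ks a.+1 b.+1 \/ same_cut ks a b.+1).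
Proof.
move=> sks pks; have [lt|ge] := ltnP b (size ks).
  have e : (nth 0%N ks b).-1.+1 = nth 0%N ks b by rewrite prednK// pks// mem_nth.
  (* Counting from 0, entry b is k_(b+1). The degree just below it lies above k_1, .., k_b only, and
     the next degree also reaches k_(b+1). *)
  exists (nth 0%N ks b).-1; split; [|left]; apply: same_cutP => k kks.
    by rewrite index_lt_nth// -ltnS e.
  by rewrite ltnS index_le_nth// e.
(* Beyond the last entry all exponents are reached, so the degrees b and b + 1 both match the
   largest entry. *)
exists (\max_(k <- ks) k).
have cut c : (size ks <= c)%N -> same_cut ks (\max_(k <- ks) k) c.
  move=> sc; apply: same_cutP => k kks.
  rewrite (leq_bigmax_seq (F := id))//; apply/esym/(leq_trans _ sc).
  by rewrite index_mem.
split; first exact: cut.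
by right; apply: cut; exact: leqW.
Qed.

Lemma mon_ideal_mingens I : is_mon_ideal I -> I = mon_ideal (mingens I).
Proof. by move=> mI; have [] := (mingensP mI (mingens I)).1 erefl. Qed.

(** Membership is tested on monomials, by divisibility by a generator. Relabelling affects only the
    exponent of x, and there [same_cut] decides. *)
Lemma same_piece_relabel I ks a b : is_mon_ideal I ->
  (forall w, mingens I w -> (w j == 0%N) || (w j \in ks)) ->
  same_cut ks a b ->
  same_piece j a b I (mon_ideal (relabel j ks @` mingens I)).
Proof.
move=> mI Iks cut g xg.
have supp (L : set S) c : is_mon_ideal L -> L ('X_j ^+ c * g) <->
    forall m, m \in msupp g -> L 'X_[U_(j) *+ c + m].
  move=> mL; rewrite (mon_ideal_supp _ mL) mpolyXn mulrC; split=> H m.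
    by move=> mg; apply: H; rewrite (perm_mem (msuppMX _ _)); apply: map_f.
  by rewrite (perm_mem (msuppMX _ _)) => /mapP[w wg ->]; exact: H.
have mI' : is_mon_ideal (mon_ideal (K := K) (relabel j ks @` mingens I)).
  by exists (relabel j ks @` mingens I).
rewrite !supp//.
have H m : m \in msupp g -> I 'X_[U_(j) *+ a + m] <->
    mon_ideal (relabel j ks @` mingens I) ('X_[U_(j) *+ b + m] : S).
  move=> /xg m0; rewrite {1}(mon_ideal_mingens mI) !mon_idealX.
  have le w : mingens I w -> (w <= U_(j) *+ a + m)%MM = (relabel j ks w <= U_(j) *+ b + m)%MM.
    move=> /Iks /cut wj.
    apply/mnm_lepP/mnm_lepP => H i; have := H i; rewrite !mnmDE !mulmnE !mnm1E mnmE eq_sym;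
      (case: eqP => [e|//]; subst i; rewrite m0 !mul1n !addn0);
      by rewrite wj.
  split=> [[w Gw]|[_ [w Gw <-]]]; rewrite ?le// => lew.
    by exists (relabel j ks w) => //; exists w.
  by exists w => //; rewrite le.
by split=> Hg m mg; apply/(H m mg); exact: Hg.
Qed.

Lemma canonical_sim I J : is_mon_ideal I -> is_mon_ideal J ->
  sim j I J (canonical_wrt (I, J) j).1 (canonical_wrt (I, J) j).2.
Proof.
move=> mI mJ; rewrite /canonical_wrt /=.
have [sks ksP] := type_ofP j I J; set ks := type_of j I J in sks ksP *.
have Gks w : (mingens I `|` mingens J) w -> (w j == 0%N) || (w j \in ks).
  move=> Gw; have [//|w0] := eqVneq (w j) 0%N.
  by apply/ksP; rewrite lt0n; split=> //; exists w.
have pI a b : same_cut ks a b ->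
    same_piece j a b I (mon_ideal (relabel j ks @` mingens I)).
  by apply: same_piece_relabel => // w Gw; apply: Gks; left.
have pJ a b : same_cut ks a b ->
    same_piece j a b J (mon_ideal (relabel j ks @` mingens J)).
  by apply: same_piece_relabel => // w Gw; apply: Gks; right.
split=> [a|b].
  have [b [ab cut]] := same_cut_right a sks; exists b.
  split; [exact: pI|exact: pJ|].
  by case: cut => cut; [left|right]; split; [exact: pI|exact: pJ|exact: pI|exact: pJ].
have [a [ab cut]] := same_cut_left b sks (fun k kks => ((ksP k).1 kks).1).
exists a; split; [exact/same_piece_sym/pI|exact/same_piece_sym/pJ|].
by case: cut => cut; [left|right]; split; apply: same_piece_sym; auto.
Qed.

End Canonical.

Theorem theorem2 (K : fieldType) (n : nat) (I J : set {mpoly K[n]})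
    (hI : is_mon_ideal I) (hJ : is_mon_ideal J) (hJI : J `<` I) :
  depth (graded_max n K) I J =
  depth (graded_max n K) (canonical_form I J).1 (canonical_form I J).2.
Proof.
rewrite /canonical_form.
elim: (enum 'I_n) I J hI hJ hJI => //= j js IH I J mI mJ JI.
have s := canonical_sim j mI mJ.
have [mI' mJ'] : is_mon_ideal (canonical_wrt (I, J) j).1 /\
                 is_mon_ideal (canonical_wrt (I, J) j).2.
  by split; rewrite /canonical_wrt /=; eexists.
rewrite (sim_depth mI mJ JI mI' mJ' s).
case: canonical_wrt s mI' mJ' => I' J' /= s mI' mJ'.
(* Strict inclusion must survive each variable. [sim_sub] transports J in I after exchanging
   numerator and denominator, and transports I' in J' back to I in J. *)
apply: IH => //; have [JsI nIJ] := JI; split.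
  exact: (sim_sub (x_graded_mon j mJ') (is_ideal_mon mI') (sim_swap s)).
move=> I'J'; apply: nIJ.
exact: (sim_sub (x_graded_mon j mI) (is_ideal_mon mJ) (sim_sym s)).
Qed.
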